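(* Let $n\ge1$ and let $Q$ be a subset of the Heisenberg group $H_n$. Let $\pi_n:H_n\to\mathbb R^{2n}$ be the projection $(t,\mathbf q,\mathbf p)\mapsto(\mathbf q,\mathbf p)$. Then $Q$ is a Kazhdan set in $H_n$ if and only if $\pi_n(Q)$ is a Kazhdan set in $\mathbb R^{2n}$.
   Context: The Heisenberg group $H_n$ is $\mathbb R\times\mathbb R^n\times\mathbb R^n$ with its usual topology and the group law $(t_1,\mathbf q_1,\mathbf p_1)\cdot(t_2,\mathbf q_2,\mathbf p_2)=(t_1+t_2+\tfrac12(\mathbf p_1\cdot\mathbf q_2-\mathbf p_2\cdot\mathbf q_1),\mathbf q_1+\mathbf q_2,\mathbf p_1+\mathbf p_2)$, where $\cdot$ is the Euclidean scalar product on $\mathbb R^n$. For a topological group $G$, a subset $Q$ is a Kazhdan set in $G$ if there exists $\varepsilon>0$ such that every strongly continuous unitary representation $\pi$ of $G$ on a complex Hilbert space having a vector $x$ with $\sup_{g\in Q}\|\pi(g)x-x\|<\varepsilon\|x\|$ has a non-zero $G$-invariant vector. *)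

(* Defs.v *)
From Stdlib Require Import Reals.
From Stdlib Require Fin.
Open Scope R_scope.

Record Cx := mkC { Re : R ; Im : R }.
Definition Cadd (a b : Cx) : Cx := mkC (Re a + Re b) (Im a + Im b).
Definition Cmul (a b : Cx) : Cx :=
  mkC (Re a * Re b - Im a * Im b) (Re a * Im b + Im a * Re b).
Definition Cconj (a : Cx) : Cx := mkC (Re a) (- Im a).
Definition Cone : Cx := mkC 1 0.

Record HilbertSpace := {
  hcar :> Type;
  hzero : hcar;
  hadd : hcar -> hcar -> hcar;
  hopp : hcar -> hcar;
  hscal : Cx -> hcar -> hcar;
  hinner : hcar -> hcar -> Cx;
  hadd_assoc : forall x y z, hadd x (hadd y z) = hadd (hadd x y) z;
  hadd_comm : forall x y, hadd x y = hadd y x;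
  hadd_zero : forall x, hadd x hzero = x;
  hadd_opp : forall x, hadd x (hopp x) = hzero;
  hscal_one : forall x, hscal Cone x = x;
  hscal_assoc : forall a b x, hscal a (hscal b x) = hscal (Cmul a b) x;
  hscal_addv : forall a x y, hscal a (hadd x y) = hadd (hscal a x) (hscal a y);
  hscal_addc : forall a b x, hscal (Cadd a b) x = hadd (hscal a x) (hscal b x);
  hinner_addl : forall x y z, hinner (hadd x y) z = Cadd (hinner x z) (hinner y z);
  hinner_scall : forall a x y, hinner (hscal a x) y = Cmul a (hinner x y);
  hinner_conj : forall x y, hinner y x = Cconj (hinner x y);
  hinner_pos : forall x, 0 <= Re (hinner x x);
  hinner_def : forall x, Re (hinner x x) = 0 -> x = hzero;
  hcomplete : forall u : nat -> hcar,
    (forall eps, eps > 0 -> exists N : nat, forall m k : nat, (N <= m)%nat -> (N <= k)%nat ->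
        sqrt (Re (hinner (hadd (u m) (hopp (u k))) (hadd (u m) (hopp (u k))))) < eps) ->
    exists l : hcar, forall eps, eps > 0 -> exists N : nat, forall m : nat, (N <= m)%nat ->
        sqrt (Re (hinner (hadd (u m) (hopp l)) (hadd (u m) (hopp l)))) < eps
}.

Definition hnorm (V : HilbertSpace) (x : V) : R := sqrt (Re (hinner V x x)).
Definition hsub (V : HilbertSpace) (x y : V) : V := hadd V x (hopp V y).

Definition unitary (V : HilbertSpace) (U : V -> V) : Prop :=
  (forall x y, U (hadd V x y) = hadd V (U x) (U y)) /\
  (forall a x, U (hscal V a x) = hscal V a (U x)) /\
  (forall x y, hinner V (U x) (U y) = hinner V x y) /\
  (forall y, exists x, U x = y).

Definition sc_unitary_rep {G : Type} (mul : G -> G -> G) (one : G) (dist : G -> G -> R)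
  (V : HilbertSpace) (pi : G -> V -> V) : Prop :=
  (forall g, unitary V (pi g)) /\
  (forall g h x, pi (mul g h) x = pi g (pi h x)) /\
  (forall x, pi one x = x) /\
  (forall g x eps, eps > 0 -> exists delta, delta > 0 /\
      forall h, dist g h < delta -> hnorm V (hsub V (pi h x) (pi g x)) < eps).

(* Kazhdan set. "sup_{g in Q} ||pi g x - x|| < eps ||x||" is encoded as the existence
   of a bound c >= 0 (sup over the empty set taken to be 0) *)
Definition Kazhdan_set {G : Type} (mul : G -> G -> G) (one : G) (dist : G -> G -> R)
  (Q : G -> Prop) : Prop :=
  exists eps, eps > 0 /\
    forall (V : HilbertSpace) (pi : G -> V -> V),
      sc_unitary_rep mul one dist V pi ->
      forall x : V,
        (exists c, 0 <= c /\ c < eps * hnorm V x /\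
           forall g, Q g -> hnorm V (hsub V (pi g x) x) <= c) ->
        exists y : V, y <> hzero V /\ forall g, pi g y = y.

Definition vec (n : nat) := Fin.t n -> R.

Fixpoint dot (n : nat) : vec n -> vec n -> R :=
  match n return vec n -> vec n -> R with
  | O => fun _ _ => 0
  | S m => fun u v => u Fin.F1 * v Fin.F1 + dot m (fun i => u (Fin.FS i)) (fun i => v (Fin.FS i))
  end.

Definition vadd {n} (u v : vec n) : vec n := fun i => u i + v i.
Definition vsub {n} (u v : vec n) : vec n := fun i => u i - v i.
Definition vzero {n} : vec n := fun _ => 0.
Definition vnorm {n} (u : vec n) : R := sqrt (dot n u u).

Definition R2n (n : nat) := (vec n * vec n)%type.
Definition r2n_add {n} (a b : R2n n) : R2n n := (vadd (fst a) (fst b), vadd (snd a) (snd b)).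
Definition r2n_zero {n} : R2n n := (vzero, vzero).
Definition r2n_dist {n} (a b : R2n n) : R :=
  sqrt (dot n (vsub (fst a) (fst b)) (vsub (fst a) (fst b))
        + dot n (vsub (snd a) (snd b)) (vsub (snd a) (snd b))).

Definition Heis (n : nat) := (R * R2n n)%type.
Definition heis_mul {n} (g h : Heis n) : Heis n :=
  let '(t1, (q1, p1)) := g in
  let '(t2, (q2, p2)) := h in
  (t1 + t2 + / 2 * (dot n p1 q2 - dot n p2 q1), (vadd q1 q2, vadd p1 p2)).
Definition heis_one {n} : Heis n := (0, r2n_zero).
Definition heis_dist {n} (g h : Heis n) : R :=
  sqrt ((fst g - fst h) ^ 2 + (r2n_dist (snd g) (snd h)) ^ 2).

Definition proj_n {n} (g : Heis n) : R2n n := snd g.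
Definition image_proj {n} (Q : Heis n -> Prop) : R2n n -> Prop :=
  fun y => exists g, Q g /\ proj_n g = y.

(* Main.v *)
Require Import Defs.
From Stdlib Require Import Reals Lra Lia.
From Stdlib Require Import FunctionalExtensionality ClassicalEpsilon.
From Stdlib Require Program.Subset.
Open Scope R_scope.
Set Implicit Arguments.
Unset Strict Implicit.

(** Let [p : G -> H] be a homomorphism with kernel [Z] and a continuous section (here
    [H_n -> R^{2n}], with [Z] the centre).  A representation of [H] is a representation of
    [G] trivial on [Z], so the image of a Kazhdan set is a Kazhdan set.

    Conversely, let [x] be almost [Q]-invariant for a representation [rho] of [G], and
    split [x = x0 + x1] with [x0] fixed by [Z] and [x1] orthogonal to all vectors fixed by
    [Z]; both parts are almost [Q]-invariant.  If [x0] is large, the vectors fixed by [Z]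
    carry a representation of [H] with an almost [p Q]-invariant vector, and we are done.
    If [x1] is large, choose by strong continuity [s] so close to [1] that [rho s x1] is
    almost [x1], such that moreover the commutator of [g] and [s] is [chi (p g)] for a
    homomorphism [chi] from [H] onto [Z].  Then [rho (chi (p g))] almost fixes [rho s x1]
    for [g] in [Q], so the representation [rho o chi] of [H] has a non-zero invariant
    vector, that is, some non-zero vector orthogonal to all vectors fixed by [Z] is fixed
    by [Z], a contradiction.

    In the Heisenberg group every [s = (0, (u, 0))] with [u <> 0] has such a [chi], because
    its commutator with [(t, (q, p))] is the central element [p . u]. *)

Lemma Rle_div_mult a b c : 0 < c -> a <= b / c -> a * c <= b.
Proof.
  intros Hc Hab. replace b with (b / c * c) by (field; lra).
  apply Rmult_le_compat_r; lra.
Qed.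

(** * Real geometry of a complex Hilbert space *)

Definition rscal (V : HilbertSpace) (r : R) (x : V) : V := hscal V (mkC r 0) x.

Section RealInnerProduct.
Variable V : HilbertSpace.
Implicit Types x y z : V.

Definition rinner x y : R := Re (hinner V x y).

Lemma rinner_addl x y z : rinner (hadd V x y) z = rinner x z + rinner y z.
Proof. unfold rinner. rewrite hinner_addl. reflexivity. Qed.

Lemma rinner_sym x y : rinner x y = rinner y x.
Proof. unfold rinner. rewrite (hinner_conj V x y). reflexivity. Qed.

Lemma rinner_addr x y z : rinner x (hadd V y z) = rinner x y + rinner x z.
Proof. rewrite !(rinner_sym x). apply rinner_addl. Qed.

Lemma rinner_zerol y : rinner (hzero V) y = 0.
Proof.
  pose proof (rinner_addl (hzero V) (hzero V) y) as H. rewrite hadd_zero in H. lra.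
Qed.

Lemma rinner_oppl x y : rinner (hopp V x) y = - rinner x y.
Proof.
  pose proof (rinner_addl x (hopp V x) y) as H. rewrite hadd_opp, rinner_zerol in H. lra.
Qed.

Lemma rinner_oppr x y : rinner x (hopp V y) = - rinner x y.
Proof. rewrite !(rinner_sym x). apply rinner_oppl. Qed.

Lemma rinner_subl x y z : rinner (hsub V x y) z = rinner x z - rinner y z.
Proof. unfold hsub. rewrite rinner_addl, rinner_oppl. reflexivity. Qed.

Lemma rinner_subr x y z : rinner x (hsub V y z) = rinner x y - rinner x z.
Proof. unfold hsub. rewrite rinner_addr, rinner_oppr. reflexivity. Qed.

Lemma rinner_scall r x y : rinner (rscal r x) y = r * rinner x y.
Proof. unfold rinner, rscal. rewrite hinner_scall. simpl. ring. Qed.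

Lemma rinner_scalr r x y : rinner x (rscal r y) = r * rinner x y.
Proof. rewrite !(rinner_sym x). apply rinner_scall. Qed.

Lemma rinner_adjoint a x y : rinner (hscal V a x) y = rinner x (hscal V (Cconj a) y).
Proof.
  rewrite (rinner_sym x). unfold rinner. rewrite !hinner_scall, (hinner_conj V x y).
  simpl. ring.
Qed.

Lemma rinner_pos x : 0 <= rinner x x.
Proof. apply hinner_pos. Qed.

Lemma rinner_eq0 x : rinner x x = 0 -> x = hzero V.
Proof. apply hinner_def. Qed.

Lemma hsub_eq0 x y : hsub V x y = hzero V -> x = y.
Proof.
  intro H. transitivity (hadd V (hsub V x y) y).
  - unfold hsub. rewrite <- hadd_assoc, (hadd_comm V _ y), hadd_opp, hadd_zero. reflexivity.
  - rewrite H, hadd_comm. apply hadd_zero.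
Qed.

Lemma rinner_ext x y : (forall z, rinner x z = rinner y z) -> x = y.
Proof. intro H. apply hsub_eq0, rinner_eq0. rewrite rinner_subl, H. ring. Qed.

End RealInnerProduct.

#[local] Hint Rewrite rinner_addl rinner_addr rinner_oppl rinner_oppr rinner_subl rinner_subr
  rinner_scall rinner_scalr rinner_zerol : rinner.

Ltac vector_eq := apply rinner_ext; intro; autorewrite with rinner; lra.

Section Distance.
Variable V : HilbertSpace.
Implicit Types x y z w : V.

Lemma hopp_rscal x : hopp V x = rscal (-1) x.
Proof. vector_eq. Qed.

Definition hdist x y : R := hnorm V (hsub V x y).

Lemma hnorm_pos x : 0 <= hnorm V x.
Proof. apply sqrt_pos. Qed.

Lemma hdist_pos x y : 0 <= hdist x y.
Proof. apply hnorm_pos. Qed.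

Lemma hnorm_sqr x : hnorm V x * hnorm V x = rinner x x.
Proof. apply sqrt_sqrt, hinner_pos. Qed.

Lemma hnorm_le x y : rinner x x <= rinner y y -> hnorm V x <= hnorm V y.
Proof. apply sqrt_le_1_alt. Qed.

Lemma hnorm_eq0 x : hnorm V x = 0 -> x = hzero V.
Proof. intro H. apply rinner_eq0. rewrite <- hnorm_sqr, H. ring. Qed.

Lemma hnorm_zero : hnorm V (hzero V) = 0.
Proof.
  unfold hnorm. fold (rinner (hzero V) (hzero V)). rewrite rinner_zerol. apply sqrt_0.
Qed.

Lemma cauchy_schwarz x y : rinner x y <= hnorm V x * hnorm V y.
Proof.
  pose proof (hnorm_pos x). pose proof (hnorm_pos y).
  destruct (Rle_lt_or_eq_dec 0 (hnorm V x * hnorm V y)) as [pos | zero].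
  - apply Rmult_le_pos; assumption.
  - pose proof (rinner_pos (hsub V (rscal (hnorm V y) x) (rscal (hnorm V x) y))) as Hpos.
    autorewrite with rinner in Hpos. rewrite (rinner_sym y x), <- !hnorm_sqr in Hpos.
    apply (Rmult_le_reg_l _ _ _ pos). nra.
  - rewrite <- zero. destruct (Rmult_integral _ _ (eq_sym zero)) as [E | E];
      apply hnorm_eq0 in E; rewrite E; [| rewrite rinner_sym]; rewrite rinner_zerol; lra.
Qed.

Lemma hnorm_triangle x y : hnorm V (hadd V x y) <= hnorm V x + hnorm V y.
Proof.
  pose proof (cauchy_schwarz x y). pose proof (hnorm_sqr (hadd V x y)) as Hsqr.
  autorewrite with rinner in Hsqr. rewrite (rinner_sym y x), <- !hnorm_sqr in Hsqr.
  pose proof (hnorm_pos x). pose proof (hnorm_pos y).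
  apply Rsqr_incr_0_var; [unfold Rsqr; nra | lra].
Qed.

Lemma hnorm_add_orthogonal x y : rinner x y = 0 -> hnorm V x <= hnorm V (hadd V x y).
Proof.
  intro orth. pose proof (rinner_pos y). apply hnorm_le.
  autorewrite with rinner. rewrite (rinner_sym y x). lra.
Qed.

Lemma hdist_triangle x y z : hdist x z <= hdist x y + hdist y z.
Proof.
  unfold hdist. replace (hsub V x z) with (hadd V (hsub V x y) (hsub V y z)) by vector_eq.
  apply hnorm_triangle.
Qed.

Lemma hdist_sym x y : hdist x y = hdist y x.
Proof. apply Rle_antisym; apply hnorm_le; autorewrite with rinner; lra. Qed.

Lemma hdist_le0_eq x y : hdist x y <= 0 -> x = y.
Proof.
  intro H. apply hsub_eq0, hnorm_eq0, Rle_antisym; [exact H | apply hdist_pos].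
Qed.

Definition hmid x y : V := rscal (/ 2) (hadd V x y).

Lemma apollonius x y z :
  hdist y z ^ 2 + 4 * hdist x (hmid y z) ^ 2 = 2 * hdist x y ^ 2 + 2 * hdist x z ^ 2.
Proof.
  unfold hdist, hmid. simpl. rewrite !Rmult_1_r, !hnorm_sqr. autorewrite with rinner.
  rewrite (rinner_sym y x), (rinner_sym z x), (rinner_sym z y). field.
Qed.

Definition converges (u : nat -> V) (l : V) : Prop :=
  forall eps, eps > 0 -> exists N : nat, forall k : nat, (N <= k)%nat -> hdist (u k) l < eps.

Definition cauchy (u : nat -> V) : Prop :=
  forall eps, eps > 0 -> exists N : nat, forall j k : nat, (N <= j)%nat -> (N <= k)%nat ->
    hdist (u j) (u k) < eps.

Lemma cauchy_converges (u : nat -> V) : cauchy u -> exists l, converges u l.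
Proof. exact (hcomplete V u). Qed.

Lemma converges_unique (u : nat -> V) l l' : converges u l -> converges u l' -> l = l'.
Proof.
  intros Hl Hl'. apply hdist_le0_eq, Rle_plus_epsilon. intros eps Heps.
  destruct (Hl (eps / 2)) as [N HN]; [lra|]. destruct (Hl' (eps / 2)) as [N' HN']; [lra|].
  set (k := Nat.max N N').
  specialize (HN k (Nat.le_max_l _ _)). specialize (HN' k (Nat.le_max_r _ _)).
  pose proof (hdist_triangle l (u k) l') as T. rewrite (hdist_sym l (u k)) in T. lra.
Qed.

Lemma rinner_limit_le (u : nat -> V) l w b :
  converges u l -> (forall k, rinner (u k) w <= b) -> rinner l w <= b.
Proof.
  intros Hl Hu. pose proof (hnorm_pos w) as Hw. apply Rle_plus_epsilon. intros eps Heps.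
  destruct (Hl (eps / (hnorm V w + 1))) as [N HN]; [apply Rdiv_lt_0_compat; lra|].
  specialize (HN N (le_n N)). apply Rlt_le, Rle_div_mult in HN; [|lra].
  pose proof (cauchy_schwarz (hsub V l (u N)) w) as CS. fold (hdist l (u N)) in CS.
  rewrite hdist_sym, rinner_subl in CS.
  pose proof (hdist_pos (u N) l). specialize (Hu N). nra.
Qed.

End Distance.

(** * Orthogonal projection onto a closed subspace *)

Lemma exists_minimizing_sequence (A : Type) (a0 : A) (f : A -> R) :
  (forall a, 0 <= f a) ->
  exists (m : R) (u : nat -> A),
    0 <= m /\ (forall a, m <= f a) /\ forall k, f (u k) <= m + RinvN k.
Proof.
  intro f_pos.
  destruct (completeness (fun r => exists a, r = - f a)) as [M [M_ub M_least]].
  { exists 0. intros r [a ->]. specialize (f_pos a). lra. }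
  { exists (- f a0), a0. reflexivity. }
  assert (approx : forall k : nat, exists a, f a <= - M + RinvN k).
  { intro k. pose proof (cond_pos (RinvN k)). apply NNPP. intro none.
    enough (M <= M - RinvN k) by lra.
    apply M_least. intros r [a ->]. apply Rnot_lt_le. intro. apply none. exists a. lra. }
  destruct (choice _ approx) as [u Hu]. exists (- M), u. split; [|split].
  - enough (M <= 0) by lra. apply M_least. intros r [a ->]. specialize (f_pos a). lra.
  - intro a. specialize (M_ub (- f a) (ex_intro _ a eq_refl)). lra.
  - exact Hu.
Qed.

Lemma RinvN_eventually_lt d : d > 0 ->
  exists N : nat, forall k : nat, (N <= k)%nat -> RinvN k < d.
Proof.
  intro Hd. destruct (RinvN_cv Hd) as [N HN]. exists N. intros k Hk.
  specialize (HN k Hk). unfold Rdist in HN. rewrite Rminus_0_r in HN.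
  apply Rabs_def2 in HN. lra.
Qed.

Section Projection.
Variable V : HilbertSpace.
Implicit Types (x y w : V) (W : V -> Prop).

Definition seq_closed W : Prop := forall u l, (forall k, W (u k)) -> converges u l -> W l.

Lemma seq_closed_complete W (u : nat -> {w | W w}) :
  seq_closed W -> cauchy (fun k => proj1_sig (u k)) ->
  exists l : {w | W w}, converges (fun k => proj1_sig (u k)) (proj1_sig l).
Proof.
  intros Wclosed Hu. destruct (cauchy_converges Hu) as [l Hl].
  assert (Wl : W l) by (refine (Wclosed _ _ _ Hl); intro k; exact (proj2_sig (u k))).
  exists (exist _ l Wl). exact Hl.
Qed.

Lemma hdist_near_minimizers x y z m d :
  0 <= m -> m <= hdist x (hmid y z) -> hdist x y <= m + d -> hdist x z <= m + d ->
  hdist y z ^ 2 <= 4 * d * (2 * m + d).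
Proof.
  intros. pose proof (apollonius x y z).
  pose proof (hdist_pos x y). pose proof (hdist_pos x z). nra.
Qed.

Lemma minimizing_sequence_cauchy x m (u : nat -> V) :
  0 <= m -> (forall j k, m <= hdist x (hmid (u j) (u k))) ->
  (forall k, hdist x (u k) <= m + RinvN k) -> cauchy u.
Proof.
  intros Hm Hmid Hu eps Heps.
  set (d := Rmin 1 (eps ^ 2 / (8 * m + 5))).
  assert (d_pos : d > 0).
  { apply Rmin_pos; [lra|]. apply Rdiv_lt_0_compat; [nra | lra]. }
  assert (d_le1 : d <= 1) by apply Rmin_l.
  assert (d_small : d * (8 * m + 5) <= eps ^ 2).
  { apply Rle_div_mult; [lra | apply Rmin_r]. }
  destruct (RinvN_eventually_lt d_pos) as [N HN].
  exists N. intros j k Hj Hk. apply HN in Hj. apply HN in Hk.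
  pose proof (Hu j). pose proof (Hu k).
  assert (hdist (u j) (u k) ^ 2 <= 4 * d * (2 * m + d)).
  { apply (hdist_near_minimizers (x := x)); auto; lra. }
  apply Rnot_le_lt. intro. nra.
Qed.

Lemma hdist_limit_le_RinvN x m (u : nat -> V) l :
  converges u l -> (forall k, hdist x (u k) <= m + RinvN k) -> hdist x l <= m.
Proof.
  intros Hl Hu. apply Rle_plus_epsilon. intros eps Heps.
  destruct (Hl (eps / 2)) as [N HN]; [lra|].
  destruct (@RinvN_eventually_lt (eps / 2)) as [N' HN']; [lra|].
  set (k := Nat.max N N').
  specialize (HN k (Nat.le_max_l _ _)). specialize (HN' k (Nat.le_max_r _ _)).
  specialize (Hu k). pose proof (hdist_triangle x (u k) l). lra.
Qed.

Lemma nearest_point_exists W x :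
  (exists w, W w) -> (forall v w, W v -> W w -> W (hmid v w)) -> seq_closed W ->
  exists w, W w /\ forall v, W v -> hdist x w <= hdist x v.
Proof.
  intros [w0 Hw0] Wmid Wclosed.
  destruct (@exists_minimizing_sequence {w | W w} (exist _ w0 Hw0)
              (fun v => hdist x (proj1_sig v))) as (m & u & Hm & m_lb & Hu).
  { intro. apply hdist_pos. }
  destruct (seq_closed_complete (u := u) Wclosed) as [[l Wl] Hl].
  { apply (minimizing_sequence_cauchy (x := x) Hm); [|exact Hu]. intros j k.
    exact (m_lb (exist _ _ (Wmid _ _ (proj2_sig (u j)) (proj2_sig (u k))))). }
  exists l. split; [exact Wl|].
  intros v Hv. apply Rle_trans with m; [|exact (m_lb (exist _ v Hv))].
  exact (hdist_limit_le_RinvN Hl Hu).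
Qed.

Record closed_subspace W : Prop := {
  subspace_zero : W (hzero V);
  subspace_add : forall x y, W x -> W y -> W (hadd V x y);
  subspace_scal : forall a x, W x -> W (hscal V a x);
  subspace_closed : seq_closed W }.

Lemma subspace_opp W : closed_subspace W -> forall x, W x -> W (hopp V x).
Proof.
  intros HW x Hx. rewrite hopp_rscal. apply (subspace_scal HW), Hx.
Qed.

Lemma subspace_sub W : closed_subspace W -> forall x y, W x -> W y -> W (hsub V x y).
Proof. intros HW x y Hx Hy. apply (subspace_add HW), (subspace_opp HW); assumption. Qed.

(* For a complex subspace, orthogonality for the real part of the inner product is the
   same as orthogonality. *)
Definition orthogonal W : V -> Prop := fun y => forall w, W w -> rinner y w = 0.

Lemma orthogonal_closed W : closed_subspace W -> closed_subspace (orthogonal W).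
Proof.
  intro HW. split.
  - intros w _. apply rinner_zerol.
  - intros x y Hx Hy w Hw. rewrite rinner_addl, Hx, Hy by assumption. ring.
  - intros a x Hx w Hw. rewrite rinner_adjoint. apply Hx, (subspace_scal HW), Hw.
  - intros u l Hu Hl.
    assert (nonpos : forall w, W w -> rinner l w <= 0).
    { intros w Hw. apply (rinner_limit_le Hl). intro k. rewrite (Hu k w Hw). lra. }
    intros w Hw. pose proof (nonpos w Hw) as upper.
    pose proof (nonpos _ (subspace_opp HW Hw)) as lower.
    rewrite rinner_oppr in lower. lra.
Qed.

Lemma nonneg_quadratic_linear_coef a b :
  0 <= a -> (forall r, 0 <= a * r ^ 2 - 2 * b * r) -> b = 0.
Proof.
  intros Ha Hquad. specialize (Hquad (b / (a + 1))). set (r := b / (a + 1)) in *.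
  assert (Eb : b = r * (a + 1)) by (unfold r; field; lra).
  assert (r ^ 2 * (a + 2) <= 0) by nra. assert (r = 0) by nra. nra.
Qed.

Lemma nearest_point_orthogonal W x w :
  closed_subspace W -> W w -> (forall v, W v -> hdist x w <= hdist x v) ->
  orthogonal W (hsub V x w).
Proof.
  intros HW Hw nearest v Hv. apply (nonneg_quadratic_linear_coef (rinner_pos v)). intro r.
  specialize (nearest _ (subspace_add HW Hw (subspace_scal HW (mkC r 0) Hv))).
  fold (rscal r v) in nearest. unfold hdist in nearest.
  replace (hsub V x (hadd V w (rscal r v)))
    with (hsub V (hsub V x w) (rscal r v)) in nearest by vector_eq.
  generalize dependent (hsub V x w). intros d nearest.
  apply Rsqr_incr_1 in nearest; [| apply hnorm_pos | apply hnorm_pos].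
  unfold Rsqr in nearest. rewrite !hnorm_sqr in nearest. autorewrite with rinner in nearest.
  rewrite (rinner_sym v d) in nearest. lra.
Qed.

Lemma orthogonal_decomposition W : closed_subspace W ->
  forall x, exists x0 x1, W x0 /\ orthogonal W x1 /\ x = hadd V x0 x1.
Proof.
  intros HW x. destruct (@nearest_point_exists W x) as (w & Hw & nearest).
  - exists (hzero V). apply (subspace_zero HW).
  - intros v w Hv Hw. apply (subspace_scal HW), (subspace_add HW); assumption.
  - apply (subspace_closed HW).
  - exists w, (hsub V x w). split; [exact Hw|]. split.
    + apply nearest_point_orthogonal; assumption.
    + vector_eq.
Qed.

End Projection.

Section SubHilbert.
Variables (V : HilbertSpace) (W : V -> Prop) (HW : closed_subspace W).

Definition sub_hilbert : HilbertSpace.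
Proof.
  unshelve refine {|
    hcar := {v : V | W v};
    hzero := exist _ (hzero V) (subspace_zero HW);
    hadd := fun x y => exist _ (hadd V (proj1_sig x) (proj1_sig y))
                         (subspace_add HW (proj2_sig x) (proj2_sig y));
    hopp := fun x => exist _ (hopp V (proj1_sig x)) (subspace_opp HW (proj2_sig x));
    hscal := fun a x => exist _ (hscal V a (proj1_sig x))
                          (subspace_scal HW a (proj2_sig x));
    hinner := fun x y => hinner V (proj1_sig x) (proj1_sig y) |};
    intros; try (apply Subset.subset_eq); simpl.
  - apply hadd_assoc.
  - apply hadd_comm.
  - apply hadd_zero.
  - apply hadd_opp.
  - apply hscal_one.
  - apply hscal_assoc.
  - apply hscal_addv.
  - apply hscal_addc.
  - apply hinner_addl.
  - apply hinner_scall.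
  - apply hinner_conj.
  - apply hinner_pos.
  - apply hinner_def. assumption.
  - exact (seq_closed_complete (subspace_closed HW) H).
Defined.

End SubHilbert.

(** * Unitary representations *)

Section Unitary.
Variables (V : HilbertSpace) (U : V -> V).
Hypothesis HU : unitary V U.

Lemma unitary_sub x y : U (hsub V x y) = hsub V (U x) (U y).
Proof.
  destruct HU as (U_add & U_scal & _). unfold hsub. rewrite U_add, !hopp_rscal.
  f_equal. apply U_scal.
Qed.

Lemma unitary_rinner x y : rinner (U x) (U y) = rinner x y.
Proof. unfold rinner. f_equal. apply HU. Qed.

Lemma unitary_norm x : hnorm V (U x) = hnorm V x.
Proof. unfold hnorm. do 2 f_equal. apply HU. Qed.

Lemma unitary_dist x y : hdist (U x) (U y) = hdist x y.
Proof. unfold hdist. rewrite <- unitary_sub. apply unitary_norm. Qed.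

Lemma unitary_zero : U (hzero V) = hzero V.
Proof. apply hnorm_eq0. rewrite unitary_norm. apply hnorm_zero. Qed.

Lemma unitary_converges (u : nat -> V) l :
  converges u l -> converges (fun k => U (u k)) (U l).
Proof.
  intros Hl eps Heps. destruct (Hl eps Heps) as [N HN]. exists N. intros k Hk.
  rewrite unitary_dist. apply HN, Hk.
Qed.

End Unitary.

(* As in the definition of a Kazhdan set, [gdist] only serves to express continuity, so no
   axiom is imposed on it. *)
Record GroupWithDist := {
  gcar :> Type;
  gmul : gcar -> gcar -> gcar;
  gone : gcar;
  ginv : gcar -> gcar;
  gdist : gcar -> gcar -> R;
  gmul_assoc : forall g h k, gmul g (gmul h k) = gmul (gmul g h) k;
  gmul_onel : forall g, gmul gone g = g;
  gmul_invl : forall g, gmul (ginv g) g = gone }.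

Arguments gmul {_} _ _.
Arguments gone {_}.
Arguments ginv {_} _.
Arguments gdist {_} _ _.

Lemma gmul_invr (G : GroupWithDist) (g : G) : gmul g (ginv g) = gone.
Proof.
  rewrite <- (gmul_onel (gmul g (ginv g))), <- (gmul_invl (ginv g)) at 1.
  rewrite <- gmul_assoc, (gmul_assoc (ginv g) g), gmul_invl, gmul_onel. apply gmul_invl.
Qed.

Definition gcontinuous (G H : GroupWithDist) (f : G -> H) : Prop :=
  forall g eps, eps > 0 -> exists delta, delta > 0 /\
    forall h, gdist g h < delta -> gdist (f g) (f h) < eps.

Lemma lipschitz_gcontinuous (G H : GroupWithDist) (f : G -> H) L :
  0 <= L -> (forall g h, gdist (f g) (f h) <= L * gdist g h) -> gcontinuous f.
Proof.
  intros HL Hf g eps Heps. exists (eps / (L + 1)). split; [apply Rdiv_lt_0_compat; lra|].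
  intros h Hh. apply Rlt_le, Rle_div_mult in Hh; [|lra]. specialize (Hf g h).
  destruct (Rle_lt_dec 0 (gdist g h)); nra.
Qed.

Record continuous_hom (G H : GroupWithDist) (f : G -> H) : Prop := {
  hom_one : f gone = gone;
  hom_mul : forall g h, f (gmul g h) = gmul (f g) (f h);
  hom_continuous : gcontinuous f }.

Definition unitary_rep (G : GroupWithDist) (V : HilbertSpace) (rho : G -> V -> V) : Prop :=
  sc_unitary_rep gmul gone gdist V rho.

Definition fixed_by (G : Type) (V : HilbertSpace) (rho : G -> V -> V)
  (Z : G -> Prop) (x : V) : Prop :=
  forall z, Z z -> rho z x = x.

Definition almost_fixed (G : Type) (V : HilbertSpace) (rho : G -> V -> V)
  (Q : G -> Prop) (c : R) (x : V) : Prop :=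
  forall g, Q g -> hdist (rho g x) x <= c.

Definition stable (G : Type) (V : HilbertSpace) (rho : G -> V -> V)
  (W : V -> Prop) : Prop :=
  forall g x, W x -> W (rho g x).

Section Representation.
Variables (G : GroupWithDist) (V : HilbertSpace) (rho : G -> V -> V).
Hypothesis Hrho : unitary_rep rho.

Lemma rep_unitary g : unitary V (rho g).
Proof. apply Hrho. Qed.

Lemma rep_mul g h x : rho (gmul g h) x = rho g (rho h x).
Proof. apply Hrho. Qed.

Lemma rep_one x : rho gone x = x.
Proof. apply Hrho. Qed.

Lemma rep_continuous g x eps : eps > 0 -> exists delta, delta > 0 /\
  forall h, gdist g h < delta -> hdist (rho h x) (rho g x) < eps.
Proof. apply Hrho. Qed.

Lemma rep_invr g x : rho g (rho (ginv g) x) = x.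
Proof. rewrite <- rep_mul, gmul_invr. apply rep_one. Qed.

(* Besides homomorphisms this covers maps that are multiplicative only modulo the kernel of
   [rho], such as sections of a quotient map. *)
Lemma unitary_rep_comp (H : GroupWithDist) (f : H -> G) :
  gcontinuous f -> (forall x, rho (f gone) x = x) ->
  (forall a b x, rho (f (gmul a b)) x = rho (gmul (f a) (f b)) x) ->
  unitary_rep (fun a : H => rho (f a)).
Proof.
  intros f_cont f_one f_mul. split; [|split; [|split]].
  - intro a. apply rep_unitary.
  - intros a b x. rewrite f_mul. apply rep_mul.
  - exact f_one.
  - intros a x eps Heps. destruct (rep_continuous (f a) x Heps) as (d & Hd & near).
    destruct (f_cont a d Hd) as (d' & Hd' & near'). exists d'. split; [exact Hd'|].
    intros b Hb. apply near, near', Hb.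
Qed.

Lemma unitary_rep_comp_hom (H : GroupWithDist) (f : H -> G) :
  continuous_hom f -> unitary_rep (fun a : H => rho (f a)).
Proof.
  intros [f_one f_mul f_cont]. apply unitary_rep_comp.
  - exact f_cont.
  - intro x. rewrite f_one. apply rep_one.
  - intros a b x. rewrite f_mul. reflexivity.
Qed.

Lemma fixed_by_closed (Z : G -> Prop) : closed_subspace (fixed_by rho Z).
Proof.
  split.
  - intros z _. apply unitary_zero, rep_unitary.
  - intros x y Hx Hy z Hz. destruct (rep_unitary z) as [rho_add _].
    rewrite rho_add, Hx, Hy by assumption. reflexivity.
  - intros a x Hx z Hz. destruct (rep_unitary z) as (_ & rho_scal & _).
    rewrite rho_scal, Hx by assumption. reflexivity.
  - intros u l Hu Hl z Hz. refine (converges_unique _ Hl).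
    replace u with (fun k => rho z (u k)).
    + apply unitary_converges; [apply rep_unitary | exact Hl].
    + extensionality k. apply Hu, Hz.
Qed.

Lemma fixed_by_stable (Z : G -> Prop) :
  (forall g z, Z z -> Z (gmul (ginv g) (gmul z g))) -> stable rho (fixed_by rho Z).
Proof.
  intros Znormal g x Hx z Hz.
  transitivity (rho g (rho (gmul (ginv g) (gmul z g)) x)).
  - rewrite !rep_mul, rep_invr. reflexivity.
  - rewrite Hx by auto. reflexivity.
Qed.

Lemma orthogonal_stable (W : V -> Prop) : stable rho W -> stable rho (orthogonal W).
Proof.
  intros Wstable g x Hx w Hw.
  rewrite <- (rep_invr g w), unitary_rinner by apply rep_unitary. apply Hx, Wstable, Hw.
Qed.

Lemma almost_fixed_orthogonal_summand (W W' : V -> Prop) (Q : G -> Prop) c x y :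
  closed_subspace W -> closed_subspace W' -> stable rho W -> stable rho W' ->
  (forall w w', W w -> W' w' -> rinner w w' = 0) ->
  W x -> W' y -> almost_fixed rho Q c (hadd V x y) -> almost_fixed rho Q c x.
Proof.
  intros HW HW' Wstable Wstable' orth Hx Hy fixed g Hg.
  apply Rle_trans with (2 := fixed g Hg). unfold hdist.
  replace (hsub V (rho g (hadd V x y)) (hadd V x y))
    with (hadd V (hsub V (rho g x) x) (hsub V (rho g y) y)).
  - apply hnorm_add_orthogonal, orth; apply subspace_sub; auto.
  - destruct (rep_unitary g) as [rho_add _]. rewrite rho_add. vector_eq.
Qed.

Lemma commutator_displacement g s z x : gmul g s = gmul z (gmul s g) ->
  hdist (rho z (rho s x)) (rho s x) <= 2 * hdist (rho g x) x + 2 * hdist (rho s x) x.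
Proof.
  intro comm.
  assert (Ez : rho z (rho s (rho g x)) = rho g (rho s x)).
  { rewrite <- (rep_mul g), comm, !rep_mul. reflexivity. }
  pose proof (hdist_triangle (rho z (rho s x)) (rho g (rho s x)) (rho s x)) as T1.
  rewrite <- Ez, !unitary_dist, Ez, (hdist_sym x) in T1 by apply rep_unitary.
  pose proof (hdist_triangle (rho g (rho s x)) (rho g x) (rho s x)) as T2.
  rewrite unitary_dist in T2 by apply rep_unitary.
  pose proof (hdist_triangle (rho g x) x (rho s x)) as T3.
  rewrite (hdist_sym x (rho s x)) in T3. lra.
Qed.

Section Restriction.
Variables (W : V -> Prop) (HW : closed_subspace W) (Wstable : stable rho W).

Definition restrict_rep (g : G) (x : sub_hilbert HW) : sub_hilbert HW :=
  exist _ (rho g (proj1_sig x)) (Wstable g (proj2_sig x)).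

Lemma unitary_rep_restrict : unitary_rep restrict_rep.
Proof.
  split; [|split; [|split]].
  - intro g. destruct (rep_unitary g) as (rho_add & rho_scal & rho_inner & _).
    split; [|split; [|split]].
    + intros x y. apply Subset.subset_eq, rho_add.
    + intros a x. apply Subset.subset_eq, rho_scal.
    + intros x y. apply rho_inner.
    + intro y. exists (restrict_rep (ginv g) y). apply Subset.subset_eq, rep_invr.
  - intros g h x. apply Subset.subset_eq, rep_mul.
  - intro x. apply Subset.subset_eq, rep_one.
  - intros g x. exact (@rep_continuous g (proj1_sig x)).
Qed.

End Restriction.

End Representation.

(** * Kazhdan sets and quotients *)

Definition has_invariant_vector (G : Type) (V : HilbertSpace) (rho : G -> V -> V) : Prop :=
  exists y, y <> hzero V /\ forall g, rho g y = y.

Definition Kazhdan_pair (G : GroupWithDist) (Q : G -> Prop) (eps : R) : Prop :=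
  forall (V : HilbertSpace) (rho : G -> V -> V), unitary_rep rho ->
  forall x : V, (exists c, 0 <= c /\ c < eps * hnorm V x /\ almost_fixed rho Q c x) ->
  has_invariant_vector rho.

Definition Kazhdan (G : GroupWithDist) (Q : G -> Prop) : Prop :=
  exists eps, eps > 0 /\ Kazhdan_pair Q eps.

Definition image (A B : Type) (f : A -> B) (Q : A -> Prop) : B -> Prop :=
  fun b => exists a, Q a /\ f a = b.

Lemma Kazhdan_image (G H : GroupWithDist) (p : G -> H) (Q : G -> Prop) :
  continuous_hom p -> (forall a, exists g, p g = a) ->
  Kazhdan Q -> Kazhdan (image p Q).
Proof.
  intros Hp surj (eps & Heps & HQ). exists eps. split; [exact Heps|].
  intros V rho Hrho x (c & Hc & Hcx & fixed).
  destruct (HQ V (fun g => rho (p g))) with (x := x) as (y & Hy & inv).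
  - apply unitary_rep_comp_hom; assumption.
  - exists c. split; [exact Hc|]. split; [exact Hcx|].
    intros g Hg. apply fixed. exists g. auto.
  - exists y. split; [exact Hy|]. intro a. destruct (surj a) as [g <-]. apply inv.
Qed.

Section Quotient.
Variables (G H : GroupWithDist) (p : G -> H).
Hypothesis Hp : continuous_hom p.

Definition kernel (g : G) : Prop := p g = gone.

Lemma kernel_normal (g z : G) : kernel z -> kernel (gmul (ginv g) (gmul z g)).
Proof.
  unfold kernel. intro Hz.
  rewrite !(hom_mul Hp), Hz, gmul_onel, <- (hom_mul Hp), gmul_invl. apply (hom_one Hp).
Qed.

Record commutator_hom_onto_kernel (s : G) (chi : H -> G) : Prop := {
  commutator_is_hom : continuous_hom chi;
  commutator_eq : forall g, gmul g s = gmul (chi (p g)) (gmul s g);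
  commutator_onto : forall z, kernel z -> exists a, chi a = z }.

Variable lift : H -> G.
Hypothesis lift_continuous : gcontinuous lift.
Hypothesis p_lift : forall a, p (lift a) = a.

Section KernelFixed.
Variables (V : HilbertSpace) (rho : G -> V -> V).
Hypothesis Hrho : unitary_rep rho.

Lemma fixed_by_kernel_stable : stable rho (fixed_by rho kernel).
Proof. apply (fixed_by_stable Hrho), kernel_normal. Qed.

Lemma fixed_by_kernel_quotient (x : V) : fixed_by rho kernel x ->
  forall g h, p g = p h -> rho g x = rho h x.
Proof.
  intros Hx g h Hgh.
  rewrite <- (gmul_onel g), <- (gmul_invr h), <- gmul_assoc, (rep_mul Hrho), Hx.
  - reflexivity.
  - unfold kernel. rewrite (hom_mul Hp), Hgh, <- (hom_mul Hp), gmul_invl.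
    apply (hom_one Hp).
Qed.

Lemma unitary_rep_quotient : (forall x, fixed_by rho kernel x) ->
  unitary_rep (fun a : H => rho (lift a)).
Proof.
  intro trivial. apply (unitary_rep_comp Hrho).
  - exact lift_continuous.
  - intro x. apply trivial. apply p_lift.
  - intros a b x. apply fixed_by_kernel_quotient; [apply trivial|].
    rewrite (hom_mul Hp), !p_lift. reflexivity.
Qed.

Lemma Kazhdan_pair_kernel_trivial (Q : G -> Prop) eps c (x : V) :
  Kazhdan_pair (image p Q) eps -> (forall v, fixed_by rho kernel v) ->
  0 <= c -> c < eps * hnorm V x -> almost_fixed rho Q c x -> has_invariant_vector rho.
Proof.
  intros HQ trivial Hc Hcx fixed.
  assert (rho_lift : forall g v, rho (lift (p g)) v = rho g v).
  { intros g v. apply fixed_by_kernel_quotient; [apply trivial | apply p_lift]. }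
  destruct (HQ V _ (unitary_rep_quotient trivial) x) as (y & Hy & inv).
  - exists c. split; [exact Hc|]. split; [exact Hcx|].
    intros a (g & Hg & <-). rewrite rho_lift. apply fixed, Hg.
  - exists y. split; [exact Hy|]. intro g. rewrite <- rho_lift. apply inv.
Qed.

End KernelFixed.

Hypothesis small_commutator_homs : forall d, d > 0 ->
  exists (s : G) (chi : H -> G), gdist gone s < d /\ commutator_hom_onto_kernel s chi.

Lemma exists_kernel_fixed_vector (V : HilbertSpace) (rho : G -> V -> V) (Q : G -> Prop)
    eps c (x : V) :
  unitary_rep rho -> Kazhdan_pair (image p Q) eps ->
  0 <= c -> 2 * c < eps * hnorm V x -> almost_fixed rho Q c x ->
  exists y, y <> hzero V /\ fixed_by rho kernel y.
Proof.
  intros Hrho HQ Hc Hcx fixed.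
  destruct (rep_continuous Hrho gone x (eps := (eps * hnorm V x - 2 * c) / 4))
    as (d & Hd & near); [lra|].
  destruct (small_commutator_homs Hd) as (s & chi & Hs & Hchi).
  specialize (near s Hs). rewrite (rep_one Hrho) in near.
  destruct (HQ V (fun a => rho (chi a))) with (x := rho s x) as (y & Hy & inv).
  - apply (unitary_rep_comp_hom Hrho), Hchi.
  - exists (2 * c + 2 * hdist (rho s x) x). split; [|split].
    + pose proof (hdist_pos (rho s x) x). lra.
    + rewrite (unitary_norm (rep_unitary Hrho s)). lra.
    + intros a (g & Hg & <-). specialize (fixed g Hg).
      pose proof (commutator_displacement Hrho x (commutator_eq Hchi g)). lra.
  - exists y. split; [exact Hy|]. intros z Hz.
    destruct (commutator_onto Hchi Hz) as [a <-]. apply inv.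
Qed.

Section FixedAndOrthogonalParts.
Variables (V : HilbertSpace) (rho : G -> V -> V) (Q : G -> Prop) (eps c : R) (x : V).
Hypothesis Hrho : unitary_rep rho.
Hypothesis HQ : Kazhdan_pair (image p Q) eps.
Hypothesis c_pos : 0 <= c.
Hypothesis fixed : almost_fixed rho Q c x.

Lemma has_invariant_vector_of_kernel_fixed :
  fixed_by rho kernel x -> c < eps * hnorm V x -> has_invariant_vector rho.
Proof.
  intros Hx Hcx. set (W := fixed_by_closed Hrho kernel).
  set (Wstable := fixed_by_kernel_stable Hrho).
  assert (trivial : forall v : sub_hilbert W, fixed_by (restrict_rep Wstable) kernel v).
  { intros v z Hz. apply Subset.subset_eq. exact (proj2_sig v z Hz). }
  destruct (Kazhdan_pair_kernel_trivial (x := exist _ x Hx : sub_hilbert W)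
              (unitary_rep_restrict Hrho W Wstable) HQ trivial c_pos Hcx fixed)
    as (y & Hy & inv).
  exists (proj1_sig y). split.
  - intro E. apply Hy, Subset.subset_eq, E.
  - intro g. exact (f_equal (@proj1_sig _ _) (inv g)).
Qed.

Lemma kernel_orthogonal_norm_le :
  orthogonal (fixed_by rho kernel) x -> eps * hnorm V x <= 2 * c.
Proof.
  intro Hx. apply Rnot_lt_le. intro Hcx.
  set (W := orthogonal_closed (fixed_by_closed Hrho kernel)).
  set (Wstable := orthogonal_stable Hrho (fixed_by_kernel_stable Hrho)).
  destruct (exists_kernel_fixed_vector (x := exist _ x Hx : sub_hilbert W)
              (unitary_rep_restrict Hrho W Wstable) HQ c_pos Hcx fixed)
    as ([y Wy] & Hy & inv).
  apply Hy, Subset.subset_eq, rinner_eq0. apply Wy. intros z Hz.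
  exact (f_equal (@proj1_sig _ _) (inv z Hz)).
Qed.

End FixedAndOrthogonalParts.

Lemma Kazhdan_preimage (Q : G -> Prop) : Kazhdan (image p Q) -> Kazhdan Q.
Proof.
  intros (eps & Heps & HQ). exists (eps / 3). split; [lra|].
  intros V rho Hrho x (c & Hc & Hcx & fixed).
  assert (HW := fixed_by_closed Hrho kernel).
  assert (HWo := orthogonal_closed HW).
  assert (Wstable := fixed_by_kernel_stable Hrho).
  assert (Wostable := orthogonal_stable Hrho Wstable).
  destruct (orthogonal_decomposition HW x) as (x0 & x1 & Hx0 & Hx1 & ->).
  assert (fixed0 : almost_fixed rho Q c x0).
  { apply (almost_fixed_orthogonal_summand Hrho HW HWo Wstable Wostable (y := x1));
      try assumption.
    intros w w' Hw Hw'. rewrite rinner_sym. apply Hw', Hw. }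
  assert (fixed1 : almost_fixed rho Q c x1).
  { rewrite hadd_comm in fixed.
    apply (almost_fixed_orthogonal_summand Hrho HWo HW Wostable Wstable (y := x0));
      try assumption.
    intros w w' Hw Hw'. apply Hw, Hw'. }
  apply (has_invariant_vector_of_kernel_fixed Hrho HQ Hc fixed0 Hx0).
  pose proof (kernel_orthogonal_norm_le Hrho HQ Hc fixed1 Hx1).
  pose proof (hnorm_triangle x0 x1). nra.
Qed.

End Quotient.

(** * The Heisenberg group *)

Definition vopp {n} (u : vec n) : vec n := fun i => - u i.

Lemma vadd_assoc n (u v w : vec n) : vadd u (vadd v w) = vadd (vadd u v) w.
Proof. extensionality i. unfold vadd. ring. Qed.

Lemma vadd_comm n (u v : vec n) : vadd u v = vadd v u.
Proof. extensionality i. apply Rplus_comm. Qed.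

Lemma vadd_zerol n (u : vec n) : vadd vzero u = u.
Proof. extensionality i. apply Rplus_0_l. Qed.

Lemma vadd_oppl n (u : vec n) : vadd (vopp u) u = vzero.
Proof. extensionality i. apply Rplus_opp_l. Qed.

Lemma vsub_diag n (u : vec n) : vsub u u = vzero.
Proof. extensionality i. apply Rminus_diag. Qed.

Lemma dot_pos n (u : vec n) : 0 <= dot n u u.
Proof. induction n; simpl; [lra|]. specialize (IHn (fun i => u (Fin.FS i))). nra. Qed.

Lemma dot_comm n (u v : vec n) : dot n u v = dot n v u.
Proof. induction n; simpl; [reflexivity|]. rewrite IHn. ring. Qed.

Lemma dot_addl n (u v w : vec n) : dot n (vadd u v) w = dot n u w + dot n v w.
Proof. induction n; simpl; [ring|]. unfold vadd in *. rewrite IHn. ring. Qed.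

Lemma dot_addr n (u v w : vec n) : dot n u (vadd v w) = dot n u v + dot n u w.
Proof. rewrite !(dot_comm u). apply dot_addl. Qed.

Lemma dot_zerol n (u : vec n) : dot n vzero u = 0.
Proof. induction n; simpl; [reflexivity|]. unfold vzero in *. rewrite IHn. ring. Qed.

Lemma dot_zeror n (u : vec n) : dot n u vzero = 0.
Proof. rewrite dot_comm. apply dot_zerol. Qed.

Lemma dot_oppl n (u v : vec n) : dot n (vopp u) v = - dot n u v.
Proof. induction n; simpl; [ring|]. unfold vopp in *. rewrite IHn. ring. Qed.

Lemma r2n_add_assoc n (a b c : R2n n) : r2n_add a (r2n_add b c) = r2n_add (r2n_add a b) c.
Proof. unfold r2n_add. simpl. rewrite !vadd_assoc. reflexivity. Qed.

Lemma r2n_add_zerol n (a : R2n n) : r2n_add r2n_zero a = a.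
Proof. destruct a. unfold r2n_add. simpl. rewrite !vadd_zerol. reflexivity. Qed.

Definition r2n_opp {n} (a : R2n n) : R2n n := (vopp (fst a), vopp (snd a)).

Lemma r2n_add_oppl n (a : R2n n) : r2n_add (r2n_opp a) a = r2n_zero.
Proof. unfold r2n_add. simpl. rewrite !vadd_oppl. reflexivity. Qed.

Definition r2n_group (n : nat) : GroupWithDist :=
  {| gdist := r2n_dist; gmul_assoc := @r2n_add_assoc n; gmul_onel := @r2n_add_zerol n;
     gmul_invl := @r2n_add_oppl n |}.

Lemma heis_mul_assoc n (g h k : Heis n) :
  heis_mul g (heis_mul h k) = heis_mul (heis_mul g h) k.
Proof.
  destruct g as [t (q, p)], h as [t' (q', p')], k as [t'' (q'', p'')]. simpl.
  rewrite !vadd_assoc, !dot_addl, !dot_addr. f_equal. ring.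
Qed.

Lemma heis_mul_centre n (t : R) (g : Heis n) :
  heis_mul (t, r2n_zero) g = (t + fst g, snd g).
Proof.
  destruct g as [t' (q, p)]. simpl. rewrite !vadd_zerol, dot_zerol, dot_zeror.
  f_equal. ring.
Qed.

Lemma heis_mul_onel n (g : Heis n) : heis_mul heis_one g = g.
Proof.
  unfold heis_one. rewrite heis_mul_centre, Rplus_0_l. symmetry. apply surjective_pairing.
Qed.

Definition heis_inv {n} (g : Heis n) : Heis n := (- fst g, r2n_opp (snd g)).

Lemma heis_mul_invl n (g : Heis n) : heis_mul (heis_inv g) g = heis_one.
Proof.
  destruct g as [t (q, p)]. unfold heis_inv, heis_one, r2n_opp, r2n_zero. simpl.
  rewrite !vadd_oppl, dot_oppl, (dot_comm p (vopp q)), dot_oppl, (dot_comm q).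
  f_equal. ring.
Qed.

Definition heis_group (n : nat) : GroupWithDist :=
  {| gdist := heis_dist; gmul_assoc := @heis_mul_assoc n; gmul_onel := @heis_mul_onel n;
     gmul_invl := @heis_mul_invl n |}.

Lemma r2n_dist_pos n (a b : R2n n) : 0 <= r2n_dist a b.
Proof. apply sqrt_pos. Qed.

Lemma r2n_dist_le_heis_dist n (g h : Heis n) : r2n_dist (snd g) (snd h) <= heis_dist g h.
Proof.
  rewrite <- (sqrt_pow2 (r2n_dist (snd g) (snd h))) by apply r2n_dist_pos.
  apply sqrt_le_1_alt. pose proof (pow2_ge_0 (fst g - fst h)). lra.
Qed.

Lemma heis_dist_same_fst n (t : R) (a b : R2n n) : heis_dist (t, a) (t, b) = r2n_dist a b.
Proof.
  unfold heis_dist. simpl fst. simpl snd.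
  replace ((t - t) ^ 2 + r2n_dist a b ^ 2) with (r2n_dist a b ^ 2) by ring.
  apply sqrt_pow2, r2n_dist_pos.
Qed.

Lemma heis_dist_same_snd n (s t : R) (a : R2n n) : heis_dist (s, a) (t, a) = Rabs (s - t).
Proof.
  assert (diag : r2n_dist a a = 0).
  { unfold r2n_dist. rewrite !vsub_diag, !dot_zerol, Rplus_0_l. apply sqrt_0. }
  unfold heis_dist. simpl fst. simpl snd. rewrite diag, <- sqrt_Rsqr_abs.
  f_equal. unfold Rsqr. ring.
Qed.

Lemma proj_n_hom n : continuous_hom (G := heis_group n) (H := r2n_group n) proj_n.
Proof.
  split.
  - reflexivity.
  - intros [t (q, p)] [t' (q', p')]. reflexivity.
  - apply (lipschitz_gcontinuous (L := 1)); [lra|]. intros g h. rewrite Rmult_1_l.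
    apply r2n_dist_le_heis_dist.
Qed.

Definition heis_lift {n} (a : R2n n) : Heis n := (0, a).

Lemma heis_lift_continuous n :
  gcontinuous (G := r2n_group n) (H := heis_group n) heis_lift.
Proof.
  apply (lipschitz_gcontinuous (L := 1)); [lra|]. intros a b. rewrite Rmult_1_l.
  right. apply heis_dist_same_fst.
Qed.

Definition axis {m} (r : R) : vec (S m) :=
  fun i => match i with Fin.F1 => r | Fin.FS _ => 0 end.

Lemma dot_axis m (u : vec (S m)) (r : R) : dot (S m) u (axis r) = r * u Fin.F1.
Proof.
  simpl. change (fun i : Fin.t m => 0) with (@vzero m). rewrite dot_zeror. ring.
Qed.

Lemma vsub_zerol_axis m (r : R) : vsub vzero (@axis m r) = axis (- r).
Proof.
  extensionality i. unfold vsub, vzero, axis.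
  refine (match i with Fin.F1 => _ | Fin.FS _ => _ end); ring.
Qed.

Definition heis_shift {m} (r : R) : Heis (S m) := (0, (axis r, vzero)).

Lemma heis_dist_one_shift m (r : R) : 0 <= r -> heis_dist heis_one (@heis_shift m r) = r.
Proof.
  intro Hr. unfold heis_one, heis_shift. rewrite heis_dist_same_fst.
  unfold r2n_dist, r2n_zero. simpl fst. simpl snd.
  rewrite vsub_diag, dot_zerol, vsub_zerol_axis, dot_axis. simpl.
  rewrite <- (sqrt_square r) at 3 by assumption. f_equal. ring.
Qed.

Lemma coord_dist_le_r2n_dist m (a b : R2n (S m)) :
  Rabs (snd a Fin.F1 - snd b Fin.F1) <= r2n_dist a b.
Proof.
  unfold r2n_dist. rewrite <- sqrt_Rsqr_abs. apply sqrt_le_1_alt. simpl.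
  pose proof (dot_pos (vsub (fst a) (fst b))) as Hq. simpl in Hq.
  pose proof (dot_pos (fun i => vsub (snd a) (snd b) (Fin.FS i))).
  unfold Rsqr. unfold vsub in *. lra.
Qed.

Definition shift_commutator {m} (r : R) (a : R2n (S m)) : Heis (S m) :=
  (r * snd a Fin.F1, r2n_zero).

Lemma shift_commutator_hom m (r : R) :
  continuous_hom (G := r2n_group (S m)) (H := heis_group (S m)) (shift_commutator r).
Proof.
  split.
  - unfold shift_commutator. simpl. unfold vzero at 1. rewrite Rmult_0_r. reflexivity.
  - intros a b. cbn [gmul heis_group]. unfold shift_commutator. rewrite heis_mul_centre.
    cbn. unfold vadd. f_equal. ring.
  - apply (lipschitz_gcontinuous (L := Rabs r)); [apply Rabs_pos|]. intros a b. simpl.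
    unfold shift_commutator.
    rewrite heis_dist_same_snd, <- Rmult_minus_distr_l, Rabs_mult.
    apply Rmult_le_compat_l; [apply Rabs_pos | apply coord_dist_le_r2n_dist].
Qed.

Lemma heis_shift_commutator_onto_kernel m (r : R) : r <> 0 ->
  commutator_hom_onto_kernel (G := heis_group (S m)) (H := r2n_group (S m)) proj_n
    (heis_shift r) (shift_commutator r).
Proof.
  intro Hr. split.
  - apply shift_commutator_hom.
  - intros [t (q, p)]. cbn [gmul heis_group]. unfold shift_commutator.
    rewrite heis_mul_centre. unfold heis_shift. cbn [heis_mul fst snd proj_n].
    rewrite dot_zerol, dot_axis, (vadd_comm q), (vadd_comm p). f_equal. field.
  - intros [t a] E. exists (vzero, axis (t / r)). unfold shift_commutator. simpl.
    unfold kernel, proj_n in E. simpl in E. rewrite E. f_equal. field. exact Hr.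
Qed.

Theorem mainTheorem14 : forall (n : nat), (1 <= n)%nat -> forall Q : Heis n -> Prop,
  Kazhdan_set (@heis_mul n) (@heis_one n) (@heis_dist n) Q <->
  Kazhdan_set (@r2n_add n) (@r2n_zero n) (@r2n_dist n) (image_proj Q).
Proof.
  intros [|m] Hn Q; [lia|]. split.
  - apply (Kazhdan_image (G := heis_group (S m)) (H := r2n_group (S m)) (proj_n_hom (S m))).
    intro a. exists (heis_lift a). reflexivity.
  - apply (Kazhdan_preimage (G := heis_group (S m)) (H := r2n_group (S m)) (proj_n_hom (S m))
             (heis_lift_continuous (n := S m))); [reflexivity|].
    intros d Hd. exists (heis_shift (d / 2)), (shift_commutator (d / 2)). split.
    + change (heis_dist heis_one (@heis_shift m (d / 2)) < d).
      rewrite heis_dist_one_shift; lra.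
    + apply heis_shift_commutator_onto_kernel. lra.
Qed.
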